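(* For each $r\in\{\downarrow,\uparrow\}$, period addition is not commutative: it is not the case that for all dates $D$ and all periods $p_1,p_2$ one has $(D+_r p_1)+_r p_2=(D+_r p_2)+_r p_1$. That is, there exist a date $D$ and periods $p_1,p_2$ such that $(D+_r p_1)+_r p_2\neq(D+_r p_2)+_r p_1$.
   Context: Values (dates). A value is either the error element $\bot$ or a triple $(y,m,d)$ of integers (year, month, day; January is month $1$); triples need not denote an existing day. ''Date'' means such a value. For an integer $y$ and $1\le m\le 12$, $\mathrm{nb\_days}(y,m)$ is the number of days of month $m$ of year $y$ in the Gregorian calendar: 31 for $m\in\{1,3,5,7,8,10,12\}$, 30 for $m\in\{4,6,9,11\}$, and for $m=2$: 29 if $y$ is leap, else 28, where $y$ is leap iff ($4\mid y$ and $100\nmid y$) or $400\mid y$. Expressions: $e ::= v \mid e +_\delta n \mid \mathrm{rnd}_r\,e$ with $v$ a value, $n\in\mathbb Z$, $\delta\in\{y,m,d\}$ ($+_y,+_m,+_d$: addition of years, months, days) and rounding mode $r\in\{\uparrow,\downarrow,\bot\}$. The small-step relation $\to$ is the least relation with the following rules, and $\to^*$ is its reflexive-transitive closure. Error rules: $\bot+_\delta n\to\bot$; $\mathrm{rnd}_r\bot\to\bot$; if $m\notin[1,12]$ then $(y,m,d)+_\delta n\to\bot$ and $\mathrm{rnd}_r(y,m,d)\to\bot$. All following rules assume $1\le m\le 12$. Congruence: if $e\to e'$ then $e+_\delta n\to e'+_\delta n$ and $\mathrm{rnd}_r e\to\mathrm{rnd}_r e'$. Years: $(y,m,d)+_y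 n\to(y+n,m,d)$. Months: if $1\le m+n\le 12$, $(y,m,d)+_m n\to(y,m+n,d)$; if $m+n<1$, $(y,m,d)+_m n\to(y-1,m,d)+_m(n+12)$; if $m+n>12$, $(y,m,d)+_m n\to(y+1,m,d)+_m(n-12)$. Days: write $N=\mathrm{nb\_days}(y,m)$. - If $d<1$ or $d>N$: $(y,m,d)+_d n\to\bot$. - If $1\le d\le N$ and $1\le d+n\le N$: $(y,m,d)+_d n\to(y,m,d+n)$. - If $1\le d\le N$ and $d+n>N$: $(y,m,d)+_d n\to((y,m,1)+_m 1)+_d(n-(N-d)-1)$. - If $1<d\le N$ and $d+n\le 0$: $(y,m,d)+_d n\to(y,m,1)+_d(d-1+n)$. - If $n+1\le 0$ and $(y,m,1)+_m(-1)\to^*(y',m',d')$ (a triple): $(y,m,1)+_d n\to(y',m',1)+_d(n+\mathrm{nb\_days}(y',m'))$. Rounding, with $N=\mathrm{nb\_days}(y,m)$: if $d<1$, $\mathrm{rnd}_r(y,m,d)\to\bot$ for every $r$; if $1\le d\le N$, $\mathrm{rnd}_r(y,m,d)\to(y,m,d)$ for every $r$; if $d>N$: $\mathrm{rnd}_\bot(y,m,d)\to\bot$, $\mathrm{rnd}_\downarrow(y,m,d)\to(y,m,N)$, and $\mathrm{rnd}_\uparrow(y,m,d)\to(y',m',1)$ where $(y,m,d)+_m 1\to^*(y',m',d')$ (a triple). A period $p$ consists of three integers: $n_y$ years, $n_m$ months, $n_d$ days. For an expression $e$ and rounding mode $r$, $e+_r p := \mathrm{rnd}_r\big((e+_y n_y)+_m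 n_m\big)+_d n_d$. Equality of expressions means that they evaluate (via $\to^*$) to the same value. *)

(* Defs.v *)
From Stdlib Require Import ZArith Bool Relations.
Open Scope Z_scope.

Inductive value : Type :=
| Bot : value
| YMD (y m d : Z) : value.

Definition is_leap (y : Z) : bool :=
  ((y mod 4 =? 0) && negb (y mod 100 =? 0)) || (y mod 400 =? 0).

(* Meaningful only for 1 <= m <= 12; the value 31 for other m is a dummy. *)
Definition nb_days (y m : Z) : Z :=
  match m with
  | 2 => if is_leap y then 29 else 28
  | 4 | 6 | 9 | 11 => 30
  | _ => 31
  end.

Inductive unit_kind : Type := Years | Months | Days.

Inductive rounding : Type := RoundUp | RoundDown | RoundBot.

Inductive expr : Type :=
| Val (v : value)
| Add (k : unit_kind) (e : expr) (n : Z)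
| Rnd (r : rounding) (e : expr).

(* Two rules have a premise about the reflexive-transitive closure of the
   relation being defined, hence the nested occurrences of [step]. *)
Inductive step : expr -> expr -> Prop :=
| step_add_bot k n :
    step (Add k (Val Bot) n) (Val Bot)
| step_rnd_bot r :
    step (Rnd r (Val Bot)) (Val Bot)
| step_add_bad_month k y m d n :
    ~ (1 <= m <= 12) ->
    step (Add k (Val (YMD y m d)) n) (Val Bot)
| step_rnd_bad_month r y m d :
    ~ (1 <= m <= 12) ->
    step (Rnd r (Val (YMD y m d))) (Val Bot)
| step_add_congr k e e' n :
    step e e' -> step (Add k e n) (Add k e' n)
| step_rnd_congr r e e' :
    step e e' -> step (Rnd r e) (Rnd r e')
| step_years y m d n :
    1 <= m <= 12 ->
    step (Add Years (Val (YMD y m d)) n) (Val (YMD (y + n) m d))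
| step_months y m d n :
    1 <= m <= 12 -> 1 <= m + n <= 12 ->
    step (Add Months (Val (YMD y m d)) n) (Val (YMD y (m + n) d))
| step_months_under y m d n :
    1 <= m <= 12 -> m + n < 1 ->
    step (Add Months (Val (YMD y m d)) n)
         (Add Months (Val (YMD (y - 1) m d)) (n + 12))
| step_months_over y m d n :
    1 <= m <= 12 -> m + n > 12 ->
    step (Add Months (Val (YMD y m d)) n)
         (Add Months (Val (YMD (y + 1) m d)) (n - 12))
| step_days_bad_day y m d n :
    1 <= m <= 12 -> d < 1 \/ d > nb_days y m ->
    step (Add Days (Val (YMD y m d)) n) (Val Bot)
| step_days y m d n :
    1 <= m <= 12 -> 1 <= d <= nb_days y m -> 1 <= d + n <= nb_days y m ->
    step (Add Days (Val (YMD y m d)) n) (Val (YMD y m (d + n)))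
| step_days_over y m d n :
    1 <= m <= 12 -> 1 <= d <= nb_days y m -> d + n > nb_days y m ->
    step (Add Days (Val (YMD y m d)) n)
         (Add Days (Add Months (Val (YMD y m 1)) 1)
              (n - (nb_days y m - d) - 1))
| step_days_under y m d n :
    1 <= m <= 12 -> 1 < d <= nb_days y m -> d + n <= 0 ->
    step (Add Days (Val (YMD y m d)) n)
         (Add Days (Val (YMD y m 1)) (d - 1 + n))
| step_days_under_first y m n y' m' d' :
    1 <= m <= 12 -> n + 1 <= 0 ->
    clos_refl_trans expr step
      (Add Months (Val (YMD y m 1)) (-1)) (Val (YMD y' m' d')) ->
    step (Add Days (Val (YMD y m 1)) n)
         (Add Days (Val (YMD y' m' 1)) (n + nb_days y' m'))
| step_rnd_bad_day r y m d :
    1 <= m <= 12 -> d < 1 ->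
    step (Rnd r (Val (YMD y m d))) (Val Bot)
| step_rnd_valid r y m d :
    1 <= m <= 12 -> 1 <= d <= nb_days y m ->
    step (Rnd r (Val (YMD y m d))) (Val (YMD y m d))
| step_rnd_err y m d :
    1 <= m <= 12 -> d > nb_days y m ->
    step (Rnd RoundBot (Val (YMD y m d))) (Val Bot)
| step_rnd_down y m d :
    1 <= m <= 12 -> d > nb_days y m ->
    step (Rnd RoundDown (Val (YMD y m d))) (Val (YMD y m (nb_days y m)))
| step_rnd_up y m d y' m' d' :
    1 <= m <= 12 -> d > nb_days y m ->
    clos_refl_trans expr step
      (Add Months (Val (YMD y m d)) 1) (Val (YMD y' m' d')) ->
    step (Rnd RoundUp (Val (YMD y m d))) (Val (YMD y' m' 1)).

Definition steps : expr -> expr -> Prop := clos_refl_trans expr step.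

Record period : Type := Period { p_years : Z; p_months : Z; p_days : Z }.

Definition add_period (r : rounding) (e : expr) (p : period) : expr :=
  Add Days
    (Rnd r (Add Months (Add Years e (p_years p)) (p_months p)))
    (p_days p).

Definition eval_eq (e1 e2 : expr) : Prop :=
  exists v : value, steps e1 (Val v) /\ steps e2 (Val v).

(* Main.v *)
Require Import Defs.
From Stdlib Require Import ZArith Relations Lia.
Open Scope Z_scope.

(** Reduction is deterministic, so an expression evaluates to at most one value.
    Take D = 2004-02-29, and let the periods be one year and one month.
    Adding the month first gives 2004-03-29 and then 2005-03-29, with no rounding.
    Adding the year first gives the non-existent 2005-02-29, which is rounded to
    2005-02-28 or 2005-03-01 and ends at 2005-03-28 or 2005-04-01. *)

Lemma val_no_step v e : ~ step (Val v) e.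
Proof. intros H; inversion H. Qed.

(** Values do not reduce and first steps agree on [S], so two runs to values coincide step by step.
    The invariant [S] lets the argument serve twice: for lone month additions, and later for all
    expressions. *)
Lemma steps_value_unique (S : expr -> Prop)
  (Sstep : forall e e', S e -> step e e' -> S e')
  (Sdet : forall e e1 e2, S e -> step e e1 -> step e e2 -> e1 = e2)
  e v w : S e -> steps e (Val v) -> steps e (Val w) -> v = w.
Proof.
  intros HS Hv Hw.
  apply clos_rt_rt1n in Hv; apply clos_rt_rt1n in Hw.
  remember (Val v) as ev eqn:Ev.
  induction Hv as [e | e e1 ev H1 Hv IH]; subst.
  - inversion Hw as [E | e1 ? H1]; subst; [congruence|].
    now apply val_no_step in H1.
  - inversion Hw as [E | e2 ? H2 Hw']; subst.
    + now apply val_no_step in H1.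
    + assert (e1 = e2) by eauto; subst; eauto.
Qed.

(** The closure premises of [step] start only from expressions of this shape. No rule that can fire
    on the shape has such a premise, so determinism here needs only inversion, which breaks the
    circularity. *)
Inductive month_redex : expr -> Prop :=
| month_redex_val v : month_redex (Val v)
| month_redex_add v n : month_redex (Add Months (Val v) n).

Lemma month_redex_step e e' : month_redex e -> step e e' -> month_redex e'.
Proof.
  intros [v | v n] H; inversion H; subst; try constructor.
  all: exfalso; eapply val_no_step; eassumption.
Qed.

Lemma month_redex_step_det e e1 e2 :
  month_redex e -> step e e1 -> step e e2 -> e1 = e2.
Proof.
  intros [v | v n] H1 H2; inversion H1; subst; inversion H2; subst;
    try reflexivity; try lia.
  all: exfalso; eapply val_no_step; eassumption.
Qed.

Lemma add_months_unique v n w w' :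
  steps (Add Months (Val v) n) (Val w) ->
  steps (Add Months (Val v) n) (Val w') -> w = w'.
Proof.
  apply (steps_value_unique month_redex month_redex_step month_redex_step_det).
  constructor.
Qed.

(** Keeps rules disjoint: day 1 never exceeds the month, and a day below 1 is never rounded up or
    down. *)
Lemma nb_days_pos y m : 1 <= nb_days y m.
Proof.
  unfold nb_days.
  repeat match goal with |- context [match ?x with _ => _ end] => destruct x end; lia.
Qed.

(* [step] recurs through the closure only in premises about a single month
   addition, which [add_months_unique] settles without induction. *)
Lemma step_det e e1 e2 : step e e1 -> step e e2 -> e1 = e2.
Proof.
  intros H1; revert e2; induction H1; intros e2 H2; inversion H2; subst;
    try reflexivity; try lia;
    try (f_equal; now auto);
    try (exfalso; eapply val_no_step; eassumption);
    try (pose proof (nb_days_pos y m); lia).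
  all: match goal with
       | H : clos_refl_trans _ _ ?e (Val _), H' : clos_refl_trans _ _ ?e (Val _) |- _ =>
         pose proof (add_months_unique _ _ _ _ H H') as E; inversion E; reflexivity
       end.
Qed.

Lemma eval_unique e v w : steps e (Val v) -> steps e (Val w) -> v = w.
Proof.
  apply (steps_value_unique (fun _ => True)); eauto using step_det.
Qed.

Lemma not_eval_eq e1 e2 v1 v2 :
  steps e1 (Val v1) -> steps e2 (Val v2) -> v1 <> v2 -> ~ eval_eq e1 e2.
Proof.
  intros H1 H2 Hne [v [K1 K2]]; apply Hne.
  now rewrite (eval_unique _ _ _ H1 K1), (eval_unique _ _ _ H2 K2).
Qed.

Lemma steps_add_congr k e e' n : steps e e' -> steps (Add k e n) (Add k e' n).
Proof.
  induction 1; [apply rt_step; now constructor | apply rt_refl | eapply rt_trans; eauto].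
Qed.

Lemma steps_rnd_congr r e e' : steps e e' -> steps (Rnd r e) (Rnd r e').
Proof.
  induction 1; [apply rt_step; now constructor | apply rt_refl | eapply rt_trans; eauto].
Qed.

(** Covers month shifts that stay within the year. The rounding step is left as a premise so that
    each mode can supply its own. Adding 0 days still takes a step, which requires the rounded date
    to exist. *)
Lemma add_period_steps r e n_y n_m y m d v :
  steps e (Val (YMD y m d)) ->
  1 <= m <= 12 -> 1 <= m + n_m <= 12 ->
  step (Rnd r (Val (YMD (y + n_y) (m + n_m) d))) (Val v) ->
  step (Add Days (Val v) 0) (Val v) ->
  steps (add_period r e (Period n_y n_m 0)) (Val v).
Proof.
  intros He Hm Hmn Hr Hd; unfold add_period; simpl.
  eapply rt_trans; [| apply rt_step; exact Hd].
  apply steps_add_congr.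
  eapply rt_trans; [| apply rt_step; exact Hr].
  apply steps_rnd_congr.
  eapply rt_trans; [| apply rt_step; now apply step_months].
  apply steps_add_congr.
  eapply rt_trans; [| apply rt_step; now apply step_years].
  now apply steps_add_congr.
Qed.

Lemma add_zero_days y m d :
  1 <= m <= 12 -> 1 <= d <= nb_days y m ->
  step (Add Days (Val (YMD y m d)) 0) (Val (YMD y m d)).
Proof.
  intros Hm Hd.
  replace (YMD y m d) with (YMD y m (d + 0)) at 2 by (f_equal; lia).
  apply step_days; lia.
Qed.

Lemma add_period_steps_valid r e n_y n_m y m d :
  steps e (Val (YMD y m d)) ->
  1 <= m <= 12 -> 1 <= m + n_m <= 12 ->
  1 <= d <= nb_days (y + n_y) (m + n_m) ->
  steps (add_period r e (Period n_y n_m 0)) (Val (YMD (y + n_y) (m + n_m) d)).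
Proof.
  intros He Hm Hmn Hd.
  eapply add_period_steps; eauto using step_rnd_valid, add_zero_days.
Qed.

Lemma month_then_year r :
  steps (add_period r (add_period r (Val (YMD 2004 2 29)) (Period 0 1 0))
           (Period 1 0 0)) (Val (YMD 2005 3 29)).
Proof.
  (* Explicit numbers let 2005 be matched with [2004 + 1] by computation; the outer addition is
     treated first. *)
  apply (add_period_steps_valid r _ 1 0 2004 3 29); [|simpl; lia ..].
  apply (add_period_steps_valid r _ 0 1 2004 2 29); [apply rt_refl | simpl; lia ..].
Qed.

Lemma year_then_month_down :
  steps (add_period RoundDown
           (add_period RoundDown (Val (YMD 2004 2 29)) (Period 1 0 0))
           (Period 0 1 0)) (Val (YMD 2005 3 28)).
Proof.
  apply (add_period_steps_valid _ _ 0 1 2005 2 28); [|simpl; lia ..].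
  apply (add_period_steps _ _ 1 0 2004 2 29); [apply rt_refl | lia | lia | |].
  - apply (step_rnd_down 2005 2 29); simpl; lia.
  - apply add_zero_days; simpl; lia.
Qed.

Lemma year_then_month_up :
  steps (add_period RoundUp
           (add_period RoundUp (Val (YMD 2004 2 29)) (Period 1 0 0))
           (Period 0 1 0)) (Val (YMD 2005 4 1)).
Proof.
  apply (add_period_steps_valid _ _ 0 1 2005 3 1); [|simpl; lia ..].
  apply (add_period_steps _ _ 1 0 2004 2 29); [apply rt_refl | lia | lia | |].
  (* The month addition in the premise keeps day 29; rounding up then replaces it by 1. *)
  - apply (step_rnd_up 2005 2 29 2005 3 29); [simpl; lia .. |].
    apply rt_step, (step_months 2005 2 29 1); lia.
  - apply add_zero_days; simpl; lia.
Qed.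

Theorem mainTheorem6 (r : rounding) (hr : r = RoundDown \/ r = RoundUp) :
  exists (D : value) (p1 p2 : period),
    ~ eval_eq (add_period r (add_period r (Val D) p1) p2)
              (add_period r (add_period r (Val D) p2) p1).
Proof.
  exists (YMD 2004 2 29), (Period 1 0 0), (Period 0 1 0).
  destruct hr; subst r.
  - eapply not_eval_eq;
      [apply year_then_month_down | apply month_then_year | discriminate].
  - eapply not_eval_eq;
      [apply year_then_month_up | apply month_then_year | discriminate].
Qed.
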